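(* The functors $G:\mathrm{CPM}(\mathbf{Rel})\to\mathcal{G}$ and $C:\mathcal{G}\to\mathrm{CPM}(\mathbf{Rel})$ are inverse to each other; in particular $\mathrm{CPM}(\mathbf{Rel})$ and $\mathcal{G}$ are isomorphic categories.
   Context: $\mathbf{Rel}$: sets and binary relations, dagger the converse relation; a relation $P: X\to X$ is positive if $P=T^\dagger\circ T$ for some relation $T: X\to Y$. $\mathrm{CPM}(\mathbf{Rel})$ has sets as objects; a morphism $A\to B$ is a relation $R\subseteq(A\times A)\times(B\times B)$ such that the relation $\overline{R}$ on $A\times B$, $\overline{R}((a_1,b_1),(a_2,b_2))\iff R(a_2,a_1,b_2,b_1)$, is positive; composition is $(S\circ R)(a,a',c,c')\iff\exists b,b'.\ R(a,a',b,b')\wedge S(b,b',c,c')$, identity $1_A(a_1,a_2,a_3,a_4)\iff a_1=a_3\wedge a_2=a_4$. A graph is a vertex set $W$ with a set $E$ of unordered pairs $\{v,w\}$ of vertices ($v=w$ allowed) such that $\{v\}\in E$ for every $v\in W$; write $V(\gamma),E(\gamma)$. The category $\mathcal{G}$ has sets as objects; a morphism $\gamma: A\to B$ is a graph whose vertex set is a subset of $A\times B$; composition: $V(\gamma'\circ\gamma)=\{(a,c)\mid\exists b.\ (a,b)\in V(\gamma)\wedge(b,c)\in V(\gamma')\}$, $E(\gamma'\circ\gamma)=\{\{(a,c),(a',c')\}\mid\exists b,b'.\ \{(a,b),(a',b')\}\in E(\gamma)\wedge\{(b,c),(b',c')\}\in E(\gamma')\}$; identity $1_A$ is the complete graph on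 $\{(a,a)\mid a\in A\}$. The functor $G$ is the identity on objects and sends $R: A\to B$ to the graph with vertices $\{(a,b)\mid R(a,a,b,b)\}$ and edges $\{\{(a,b),(a',b')\}\mid R(a,a',b,b')\}$. The functor $C$ is the identity on objects and sends a graph $\gamma: A\to B$ to the relation $C(\gamma)(a,a',b,b')\iff\{(a,b),(a',b')\}\in E(\gamma)$. *)

(* Defs.v *)
From mathcomp Require Import all_boot.
From mathcomp Require Import boolp classical_sets.

Set Implicit Arguments.
Unset Strict Implicit.
Unset Printing Implicit Defensive.

Local Open Scope classical_set_scope.

Record category := Category {
  obj :> Type;
  hom : obj -> obj -> Type;
  idm : forall X, hom X X;
  comp : forall X Y Z, hom Y Z -> hom X Y -> hom X Z;
  comp_idl : forall X Y (f : hom X Y), comp (idm Y) f = f;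
  comp_idr : forall X Y (f : hom X Y), comp f (idm X) = f;
  compA : forall X Y Z W (h : hom Z W) (g : hom Y Z) (f : hom X Y),
    comp h (comp g f) = comp (comp h g) f }.

Record functor (C D : category) := Functor {
  fobj : C -> D;
  fmap : forall X Y : C, hom X Y -> hom (fobj X) (fobj Y);
  fmap_id : forall X : C, fmap (idm X) = idm (fobj X);
  fmap_comp : forall (X Y Z : C) (g : hom Y Z) (f : hom X Y),
    fmap (comp g f) = comp (fmap g) (fmap f) }.

Definition functor_id (C : category) : functor C C :=
  @Functor C C id (fun _ _ => id) (fun=> erefl) (fun _ _ _ _ _ => erefl).

Lemma functor_comp_idm (C D E : category) (H : functor D E) (F : functor C D)
    (X : C) :
  fmap H (fmap F (idm X)) = idm (fobj H (fobj F X)).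
Proof. by rewrite !fmap_id. Qed.

Lemma functor_comp_comp (C D E : category) (H : functor D E) (F : functor C D)
    (X Y Z : C) (g : hom Y Z) (f : hom X Y) :
  fmap H (fmap F (comp g f)) = comp (fmap H (fmap F g)) (fmap H (fmap F f)).
Proof. by rewrite !fmap_comp. Qed.

Definition functor_comp (C D E : category) (H : functor D E) (F : functor C D) :
    functor C E :=
  @Functor C E (fun X => fobj H (fobj F X))
    (fun X Y (f : hom X Y) => fmap H (fmap F f))
    (functor_comp_idm H F) (@functor_comp_comp C D E H F).

Definition inverse_functors (C D : category)
    (F : functor C D) (H : functor D C) :=
  functor_comp H F = functor_id C /\ functor_comp F H = functor_id D.

Definition isomorphic_categories (C D : category) :=
  exists (F : functor C D) (H : functor D C), inverse_functors F H.

(* A relation X -> Y is a set (X * Y).  In relation_scope [S \; T] is T followed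
   by S, so [T^-1 \; T] is the composite of T with its converse, on X. *)
Definition positive (X : Type) (P : set (X * X)) :=
  exists (Y : Type) (T : set (X * Y)), P = (T^-1 \; T)%relation.

Lemma positiveP (X : Type) (P : set (X * X)) :
  positive P <-> (forall x y, P (x, y) -> P (y, x)) /\
                 (forall x y, P (x, y) -> P (x, x)).
Proof.
split=> [[Y [T ->]]|[sP rP]].
  by split=> x y [z /= Tx Ty]; exists z.
exists (X * X)%type, [set p | P p.2 /\ (p.1 = p.2.1 \/ p.1 = p.2.2)].
apply/seteqP; split=> [[x y] Pxy|[x y] [[u v] /= [Puv xE] [_ yE]]].
  by exists (x, y); split => //=; [left|right].
move: xE yE; have Pvu := sP _ _ Puv.
by case=> -> [] -> //; [apply: rP Puv|apply: rP Pvu].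
Qed.

Definition bar (A B : Type) (R : set ((A * A) * (B * B))) :
    set ((A * B) * (A * B)) :=
  [set p | let: ((a1, b1), (a2, b2)) := p in R ((a2, a1), (b2, b1))].

(* [cpm_rel R ((a, a'), (b, b'))] is R(a, a', b, b'). *)
Record cpm (A B : Type) := Cpm {
  cpm_rel : set ((A * A) * (B * B));
  cpm_positive : positive (bar cpm_rel) }.

Lemma bar_positiveP (A B : Type) (R : set ((A * A) * (B * B))) :
  positive (bar R) <->
  (forall a a' b b', R ((a, a'), (b, b')) -> R ((a', a), (b', b))) /\
  (forall a a' b b', R ((a, a'), (b, b')) -> R ((a, a), (b, b))).
Proof.
split=> [/positiveP[sR rR]|[sR rR]].
  split=> a a' b b' Rab; first exact: (sR (a', b') (a, b)).
  exact: (rR (a, b) (a', b') (sR (a', b') (a, b) Rab)).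
apply/positiveP; split; case=> a b [a' b']; first exact: sR.
by move=> /sR /rR.
Qed.

Lemma cpm_sym A B (R : cpm A B) a a' b b' :
  cpm_rel R ((a, a'), (b, b')) -> cpm_rel R ((a', a), (b', b)).
Proof. by have /bar_positiveP[sR _] := cpm_positive R; exact: sR. Qed.

Lemma cpm_refl A B (R : cpm A B) a a' b b' :
  cpm_rel R ((a, a'), (b, b')) -> cpm_rel R ((a, a), (b, b)).
Proof. by have /bar_positiveP[_] := cpm_positive R; exact. Qed.

Lemma cpm_eq A B (R S : cpm A B) :
  (forall a a' b b',
    cpm_rel R ((a, a'), (b, b')) <-> cpm_rel S ((a, a'), (b, b'))) -> R = S.
Proof.
case: R S => [R pR] [S pS] /= RS.
have eRS : R = S by apply/seteqP; split; case=> -[a a'] [b b'] /RS.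
by move: pS; rewrite -eRS => pS; congr Cpm; exact: Prop_irrelevance.
Qed.

Definition cpm_id_rel (A : Type) : set ((A * A) * (A * A)) :=
  [set p | let: ((a1, a2), (a3, a4)) := p in a1 = a3 /\ a2 = a4].

Definition cpm_comp_rel (A B C : Type) (S : set ((B * B) * (C * C)))
    (R : set ((A * A) * (B * B))) : set ((A * A) * (C * C)) :=
  [set p | let: ((a, a'), (c, c')) := p in
    exists b b', R ((a, a'), (b, b')) /\ S ((b, b'), (c, c'))].

Lemma cpm_id_positive A : positive (bar (@cpm_id_rel A)).
Proof. by apply/bar_positiveP; split=> a a' b b' /= []. Qed.

Lemma cpm_comp_positive A B C (S : cpm B C) (R : cpm A B) :
  positive (bar (cpm_comp_rel (cpm_rel S) (cpm_rel R))).
Proof.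
apply/bar_positiveP; split=> a a' c c' /= [b [b' [Rab Sbc]]].
  by exists b', b; split; apply: cpm_sym.
by exists b, b; split; [apply: cpm_refl Rab|apply: cpm_refl Sbc].
Qed.

Definition cpm_id A : cpm A A := Cpm (@cpm_id_positive A).

Definition cpm_comp A B C (S : cpm B C) (R : cpm A B) : cpm A C :=
  Cpm (cpm_comp_positive S R).

Lemma cpm_comp_idl A B (R : cpm A B) : cpm_comp (cpm_id B) R = R.
Proof.
apply: cpm_eq => a a' b b'; split=> [[? [? [/= + [<- <-]]]] //|Rab].
by exists b, b'.
Qed.

Lemma cpm_comp_idr A B (R : cpm A B) : cpm_comp R (cpm_id A) = R.
Proof.
apply: cpm_eq => a a' b b'; split=> [[? [? [/= [<- <-]]]] //|Rab].
by exists a, a'.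
Qed.

Lemma cpm_compA A B C D (T : cpm C D) (S : cpm B C) (R : cpm A B) :
  cpm_comp T (cpm_comp S R) = cpm_comp (cpm_comp T S) R.
Proof.
apply: cpm_eq => a a' d d'; split.
  move=> [c [c' [[b [b' [Rab Sbc]]] Tcd]]].
  by exists b, b'; split=> //; exists c, c'.
move=> [b [b' [Rab [c [c' [Sbc Tcd]]]]]].
by exists c, c'; split=> //; exists b, b'.
Qed.

Definition CPMRel : category :=
  @Category Type cpm cpm_id cpm_comp cpm_comp_idl cpm_comp_idr cpm_compA.

(* Graphs whose vertex set is a subset of X.  The unordered pair {v, w} is the
   set [set v; w], so that {v, v} is the singleton [set v]. *)
Record graph (X : Type) := Graph {
  vertices : set X;
  edges : set (set X);
  edges_pair : forall e, edges e ->
    exists v w, [/\ vertices v, vertices w & e = [set v; w]];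
  edges_loop : forall v, vertices v -> edges [set v] }.

Lemma set2_eqP (X : Type) (x y z w : X) :
  [set x; y] = [set z; w] -> (x = z /\ y = w) \/ (x = w /\ y = z).
Proof.
move=> e.
have xe : [set z; w] x by rewrite -e; left.
have ye : [set z; w] y by rewrite -e; right.
have ze : [set x; y] z by rewrite e; left.
have we : [set x; y] w by rewrite e; right.
by case: xe ye ze we => [] ? [] ? [] ? [] ?; subst; auto.
Qed.

Lemma edges_endpoints X (g : graph X) v w :
  edges g [set v; w] -> vertices g v /\ vertices g w.
Proof.
move=> /edges_pair[x [y [xV yV E]]].
by case: (set2_eqP E) => -[-> ->].
Qed.

Lemma graph_eq X (g h : graph X) :
  (forall v, vertices g v <-> vertices h v) ->
  (forall v w, edges g [set v; w] <-> edges h [set v; w]) -> g = h.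
Proof.
move=> eV eE.
have eqV : vertices g = vertices h by apply/seteqP; split=> v /eV.
have eqE : edges g = edges h.
  apply/seteqP; split=> e ee; have [v [w [_ _ E]]] := edges_pair ee.
    by move: ee; rewrite E => /eE.
  by move: ee; rewrite E => /eE.
case: g h {eV eE} eqV eqE => [V E p l] [V' E' p' l'] /= eV eE.
move: p' l'; rewrite -eV -eE => p' l'.
by congr Graph; exact: Prop_irrelevance.
Qed.

Section GraphIdentity.

Variable A : Type.

Definition graph_id_vertices : set (A * A) := [set v | exists a, v = (a, a)].

Definition graph_id_edges : set (set (A * A)) :=
  [set e | exists v w,
    [/\ graph_id_vertices v, graph_id_vertices w & e = [set v; w]]].

Lemma graph_id_loop v : graph_id_vertices v -> graph_id_edges [set v].
Proof. by move=> Vv; exists v, v; split=> //; rewrite setUid. Qed.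

Definition graph_id : graph (A * A) :=
  @Graph _ graph_id_vertices graph_id_edges (fun=> id) graph_id_loop.

End GraphIdentity.

Section GraphComposition.

Variables (A B C : Type) (h : graph (B * C)) (g : graph (A * B)).

Definition graph_comp_vertices : set (A * C) :=
  [set v | let: (a, c) := v in
    exists b, vertices g (a, b) /\ vertices h (b, c)].

Definition graph_comp_edges : set (set (A * C)) :=
  [set e | exists a c a' c', e = [set (a, c); (a', c')] /\
    exists b b', edges g [set (a, b); (a', b')] /\
                 edges h [set (b, c); (b', c')]].

Lemma graph_comp_pair e : graph_comp_edges e ->
  exists v w, [/\ graph_comp_vertices v, graph_comp_vertices w &
    e = [set v; w]].
Proof.
move=> [a [c [a' [c' [-> [b [b' [ge he]]]]]]]].
have [gv gw] := edges_endpoints ge; have [hv hw] := edges_endpoints he.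
exists (a, c), (a', c'); split=> //; first by exists b.
by exists b'.
Qed.

Lemma graph_comp_loop v : graph_comp_vertices v -> graph_comp_edges [set v].
Proof.
case: v => a c [b [gab hbc]].
exists a, c, a, c; rewrite setUid; split=> //.
by exists b, b; rewrite !setUid; split; exact: edges_loop.
Qed.

Definition graph_comp : graph (A * C) := Graph graph_comp_pair graph_comp_loop.

End GraphComposition.

Lemma vertices_compE A B C (h : graph (B * C)) (g : graph (A * B)) a c :
  vertices (graph_comp h g) (a, c) <->
  exists b, vertices g (a, b) /\ vertices h (b, c).
Proof. by []. Qed.

Lemma edges_compE A B C (h : graph (B * C)) (g : graph (A * B)) a c a' c' :
  edges (graph_comp h g) [set (a, c); (a', c')] <->
  exists b b', edges g [set (a, b); (a', b')] /\
               edges h [set (b, c); (b', c')].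
Proof.
split=> [|H]; last by exists a, c, a', c'.
move=> [x [z [x' [z' [E [b [b' [ge he]]]]]]]].
case: (set2_eqP E) => -[[-> ->] [-> ->]]; first by exists b, b'.
by exists b', b; rewrite setUC [X in edges h X]setUC.
Qed.

Lemma vertices_idE A (a b : A) : vertices (graph_id A) (a, b) <-> a = b.
Proof. by split=> [[c [-> ->]]|->] //; exists b. Qed.

Lemma edges_idE A (a b a' b' : A) :
  edges (graph_id A) [set (a, b); (a', b')] <-> a = b /\ a' = b'.
Proof.
split=> [e|[-> ->]].
  by have [/vertices_idE ? /vertices_idE ?] := edges_endpoints e.
by exists (b, b), (b', b'); split=> //; [exists b|exists b'].
Qed.

Lemma graph_comp_idl A B (g : graph (A * B)) : graph_comp (graph_id B) g = g.
Proof.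
apply: graph_eq => [[a b]|[a b] [a' b']].
  rewrite vertices_compE; split=> [[c [+ /vertices_idE <-]]//|gab].
  by exists b; split=> //; apply/vertices_idE.
rewrite edges_compE; split=> [[c [c' [+ /edges_idE[<- <-]]]]//|gab].
by exists b, b'; split=> //; apply/edges_idE.
Qed.

Lemma graph_comp_idr A B (g : graph (A * B)) : graph_comp g (graph_id A) = g.
Proof.
apply: graph_eq => [[a b]|[a b] [a' b']].
  rewrite vertices_compE; split=> [[c [/vertices_idE <-]]//|gab].
  by exists a; split=> //; apply/vertices_idE.
rewrite edges_compE; split=> [[c [c' [/edges_idE[<- <-]]]]//|gab].
by exists a, a'; split=> //; apply/edges_idE.
Qed.

Lemma graph_compA A B C D (k : graph (C * D)) (h : graph (B * C))
    (g : graph (A * B)) :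
  graph_comp k (graph_comp h g) = graph_comp (graph_comp k h) g.
Proof.
apply: graph_eq => [[a d]|[a d] [a' d']].
  rewrite !vertices_compE; split.
    move=> [c [/vertices_compE[b [gab hbc]] kcd]]; exists b; split=> //.
    by apply/vertices_compE; exists c.
  move=> [b [gab /vertices_compE[c [hbc kcd]]]]; exists c; split=> //.
  by apply/vertices_compE; exists b.
rewrite !edges_compE; split.
  move=> [c [c' [/edges_compE[b [b' [gab hbc]]] kcd]]].
  by exists b, b'; split=> //; apply/edges_compE; exists c, c'.
move=> [b [b' [gab /edges_compE[c [c' [hbc kcd]]]]]].
by exists c, c'; split=> //; apply/edges_compE; exists b, b'.
Qed.

Definition GraphCat : category :=
  @Category Type (fun A B => graph (A * B)) graph_id graph_comp
    graph_comp_idl graph_comp_idr graph_compA.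

Section GraphOfCpm.

Variables (A B : Type) (R : cpm A B).

Definition graph_of_cpm_vertices : set (A * B) :=
  [set v | let: (a, b) := v in cpm_rel R ((a, a), (b, b))].

Definition graph_of_cpm_edges : set (set (A * B)) :=
  [set e | exists a b a' b',
    cpm_rel R ((a, a'), (b, b')) /\ e = [set (a, b); (a', b')]].

Lemma graph_of_cpm_pair e : graph_of_cpm_edges e ->
  exists v w, [/\ graph_of_cpm_vertices v, graph_of_cpm_vertices w &
    e = [set v; w]].
Proof.
move=> [a [b [a' [b' [Rab ->]]]]].
exists (a, b), (a', b'); split=> //.
  exact: cpm_refl Rab.
exact: cpm_refl (cpm_sym Rab).
Qed.

Lemma graph_of_cpm_loop v :
  graph_of_cpm_vertices v -> graph_of_cpm_edges [set v].
Proof. by case: v => a b Rab; exists a, b, a, b; rewrite setUid. Qed.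

Definition graph_of_cpm : graph (A * B) :=
  Graph graph_of_cpm_pair graph_of_cpm_loop.

End GraphOfCpm.

Lemma vertices_of_cpmE A B (R : cpm A B) a b :
  vertices (graph_of_cpm R) (a, b) <-> cpm_rel R ((a, a), (b, b)).
Proof. by []. Qed.

Lemma edges_of_cpmE A B (R : cpm A B) a b a' b' :
  edges (graph_of_cpm R) [set (a, b); (a', b')] <->
  cpm_rel R ((a, a'), (b, b')).
Proof.
split=> [|Rab]; last by exists a, b, a', b'.
move=> [x [y [x' [y' [Rxy E]]]]].
by case: (set2_eqP E) => -[[-> ->] [-> ->]] //; exact: cpm_sym.
Qed.

Definition cpm_of_graph_rel A B (g : graph (A * B)) : set ((A * A) * (B * B)) :=
  [set p | let: ((a, a'), (b, b')) := p in edges g [set (a, b); (a', b')]].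

Lemma cpm_of_graph_positive A B (g : graph (A * B)) :
  positive (bar (cpm_of_graph_rel g)).
Proof.
apply/bar_positiveP; split=> a a' b b' /=; first by rewrite setUC.
move=> e; have [gab _] := edges_endpoints e.
by rewrite setUid; exact: edges_loop.
Qed.

Definition cpm_of_graph A B (g : graph (A * B)) : cpm A B :=
  Cpm (cpm_of_graph_positive g).

Lemma graph_of_cpm_id A : graph_of_cpm (cpm_id A) = graph_id A.
Proof.
apply: graph_eq => [[a b]|[a b] [a' b']].
  by rewrite vertices_of_cpmE vertices_idE /=; split=> [[]|->].
by rewrite edges_of_cpmE edges_idE.
Qed.

Lemma graph_of_cpm_comp A B C (S : cpm B C) (R : cpm A B) :
  graph_of_cpm (cpm_comp S R) = graph_comp (graph_of_cpm S) (graph_of_cpm R).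
Proof.
apply: graph_eq => [[a c]|[a c] [a' c']].
  rewrite vertices_of_cpmE vertices_compE; split=> [[b [b' [Rab Sbc]]]|].
    exists b; rewrite !vertices_of_cpmE.
    by split; [apply: cpm_refl Rab|apply: cpm_refl Sbc].
  by move=> [b [/vertices_of_cpmE Rab /vertices_of_cpmE Sbc]]; exists b, b.
rewrite edges_of_cpmE edges_compE; split=> -[b [b' [Rab Sbc]]]; exists b, b'.
  by rewrite !edges_of_cpmE.
by move: Rab Sbc; rewrite !edges_of_cpmE.
Qed.

Lemma cpm_of_graph_id A : cpm_of_graph (graph_id A) = cpm_id A.
Proof. by apply: cpm_eq => a a' b b'; exact: edges_idE. Qed.

Lemma cpm_of_graph_comp A B C (h : graph (B * C)) (g : graph (A * B)) :
  cpm_of_graph (graph_comp h g) = cpm_comp (cpm_of_graph h) (cpm_of_graph g).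
Proof. by apply: cpm_eq => a a' c c'; exact: edges_compE. Qed.

Definition functorG : functor CPMRel GraphCat :=
  @Functor CPMRel GraphCat id graph_of_cpm graph_of_cpm_id graph_of_cpm_comp.

Definition functorC : functor GraphCat CPMRel :=
  @Functor GraphCat CPMRel id cpm_of_graph cpm_of_graph_id cpm_of_graph_comp.

(* Main.v *)
From mathcomp Require Import all_boot.
From mathcomp Require Import boolp classical_sets.
Require Import Defs.

Set Implicit Arguments.
Unset Strict Implicit.
Unset Printing Implicit Defensive.

(** A relation on [A * B] is positive exactly when it is symmetric and relates to itself every point
    that it relates to something. This is the adjacency relation of a graph whose vertices are the
    points carrying a loop, so both functors only change the presentation of the same data. They
    cancel on morphisms by [graph_of_cpmK] and [cpm_of_graphK]; [functor_id_eq] lifts this to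
    equality of functors. *)

Lemma graph_of_cpmK A B (R : cpm A B) : cpm_of_graph (graph_of_cpm R) = R.
Proof. by apply: cpm_eq => a a' b b'; exact: edges_of_cpmE. Qed.

(** The vertex set, which [cpm_of_graph] forgets, is recovered from the loops: every vertex has one,
    and endpoints of edges are vertices. *)
Lemma cpm_of_graphK A B (g : graph (A * B)) :
  graph_of_cpm (cpm_of_graph g) = g.
Proof.
apply: graph_eq => [[a b]|[a b] [a' b']]; last by rewrite edges_of_cpmE.
rewrite vertices_of_cpmE /=; split=> [e|].
  by have [] := edges_endpoints e.
by rewrite setUid; exact: edges_loop.
Qed.

Lemma functor_id_eq (C : category)
    (m : forall X Y : C, hom X Y -> hom X Y)
    (m_id : forall X : C, m X X (idm X) = idm X)
    (m_comp : forall (X Y Z : C) (g : hom Y Z) (f : hom X Y),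
      m X Z (comp g f) = comp (m Y Z g) (m X Y f)) :
  (forall X Y (f : hom X Y), m X Y f = f) ->
  @Functor C C id m m_id m_comp = functor_id C.
Proof.
move=> mE; have {}mE : m = fun _ _ => id.
  apply: functional_extensionality_dep => X.
  apply: functional_extensionality_dep => Y.
  by apply: functional_extensionality_dep => f; exact: mE.
move: m_id m_comp; rewrite mE => m_id m_comp.
by congr Functor; exact: Prop_irrelevance.
Qed.

Theorem theorem4p12 :
  inverse_functors functorG functorC /\ isomorphic_categories CPMRel GraphCat.
Proof.
have GC_inv : inverse_functors functorG functorC.
  (* Both composites have an object map convertible to [id]. *)
  split; apply: functor_id_eq => A B; first exact: graph_of_cpmK.
  exact: cpm_of_graphK.
by split=> //; exists functorG, functorC.
Qed.
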